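(* Let $G$ be a finite group of A-type. Then $G$ is of central type if and only if for every prime $p$, the $p$-Sylow subgroup $G_p$ is of central type and the action of its Weyl group $W(G_p)$ on $G_p$ is symplectic.
   Context: A finite group $G$ is of A-type if all its Sylow subgroups are abelian. $G_p$ denotes a $p$-Sylow subgroup of $G$. For a subgroup $H\le G$ the Weyl group is $W(H)=\mathcal{N}_G(H)/H$; when $H$ is abelian (as $G_p$ is here) it acts on $H$ by conjugation. For a finite group $G$ and a 2-cocycle $f\in Z^2(G,\mathbb{C}^* )$ (trivial action of $G$ on $\mathbb{C}^*$), the twisted group algebra $\mathbb{C}^fG$ is the $\mathbb{C}$-algebra with basis $\{u_g\}_{g\in G}$ and multiplication $u_{g}u_{h}=f(g,h)u_{gh}$. The class $[f]\in H^2(G,\mathbb{C}^* )$ is non-degenerate if $\mathbb{C}^fG$ is isomorphic to a matrix algebra over $\mathbb{C}$ (i.e. is simple). A finite group is of central type if it admits a non-degenerate class. $\mathrm{Aut}(G)$ acts on $H^2(G,\mathbb{C}^* )$ by $\phi([f])=[\phi(f)]$, $\phi(f)(g_1,g_2)=f(\phi^{-1}(g_1),\phi^{-1}(g_2))$. An action $\eta:K\to\mathrm{Aut}(N)$ of a group $K$ on a finite group $N$ is symplectic if there exists a non-degenerate class $[f]\in H^2(N,\mathbb{C}^* )$ with $\eta(k)([f])=[f]$ for all $k\in K$. *)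

(* Defs.v *)
From HB Require Import structures.
From mathcomp Require Import all_boot all_order all_algebra.
From mathcomp Require Import all_fingroup all_solvable.

Set Implicit Arguments.
Unset Strict Implicit.
Unset Printing Implicit Defensive.

Import GroupScope GRing.Theory.
Local Open Scope ring_scope.

(* Multiplicative 2-cocycles, for the trivial action of G on F^*. Only the    *)
(* values on G x G are constrained.                                           *)
Definition is_cocycle2 (F : fieldType) (gT : finGroupType) (G : {group gT})
    (f : gT -> gT -> F) : Prop :=
  {in G &, forall x y, f x y != 0} /\
  {in G & &, forall x y z,
     f x y * f (x * y)%g z = f y z * f x (y * z)%g}.

Record cocycle2 (F : fieldType) (gT : finGroupType) (G : {group gT}) := Cocycle2 {
  cocycle2_fun :> gT -> gT -> F;
  cocycle2P : is_cocycle2 G cocycle2_fun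
}.

(* Equality of classes in H^2(G, F^* ). *)
Definition cohomologous (F : fieldType) (gT : finGroupType) (G : {group gT})
    (f1 f2 : gT -> gT -> F) : Prop :=
  exists2 l : gT -> F, {in G, forall x, l x != 0} &
    {in G &, forall x y, f1 x y = (l x * l y / l (x * y)%g) * f2 x y}.

(* An alias of {ffun [subg G] -> F}, on which the pointwise product of finite *)
(* functions is replaced by the twisted convolution.                          *)
Definition twisted_group_algebra (F : fieldType) (gT : finGroupType)
    (G : {group gT}) (f : cocycle2 F G) : Type := {ffun subg_of G -> F^o}.

Section TwistedGroupAlgebra.
Variables (F : fieldType) (gT : finGroupType) (G : {group gT}).
Variable f : cocycle2 F G.
Local Notation A := (twisted_group_algebra f).
Implicit Types (a b c : A) (x y z : subg_of G).

HB.instance Definition _ := GRing.Lmodule.copy A {ffun subg_of G -> F^o}.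

Definition tga_basis x : A := [ffun z => (z == x)%:R].
Local Notation u := tga_basis.

Let fv x y : F := f (sgval x) (sgval y).

Definition tga_mul a b : A :=
  \sum_x \sum_y (a x * b y * f (sgval x) (sgval y)) *: tga_basis (x * y)%g.

(* u_1 u_1 = f(1, 1) u_1, so the unit is u_1 / f(1, 1). *)
Definition tga_one : A := (f 1%g 1%g)^-1 *: tga_basis 1%g.

Let fv_neq0 x y : fv x y != 0.
Proof. by case: (cocycle2P f) => + _; apply; apply: subgP. Qed.

Let fvM x y z : fv x y * fv (x * y)%g z = fv y z * fv x (y * z)%g.
Proof.
rewrite /fv !sgvalM ?inE //.
by case: (cocycle2P f) => _; apply; apply: subgP.
Qed.

Let fv1x x : fv 1%g x = fv 1%g 1%g.
Proof.
by have := fvM 1%g 1%g x; rewrite !mul1g => /(mulIf (fv_neq0 _ _)) ->.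
Qed.

Let fvx1 x : fv x 1%g = fv 1%g 1%g.
Proof.
by have := fvM x 1%g 1%g; rewrite !mulg1 => /(mulIf (fv_neq0 _ _)).
Qed.

Lemma tga_sumE a : a = \sum_x a x *: tga_basis x.
Proof.
apply/ffunP=> z; rewrite sum_ffunE (bigD1 z) //= big1 => [|x neq_xz].
  by rewrite !ffunE eqxx addr0 /GRing.scale /= mulr1.
by rewrite !ffunE eq_sym (negbTE neq_xz) scaler0.
Qed.

Let mulDl : left_distributive tga_mul +%R.
Proof.
move=> a b c; rewrite /tga_mul -big_split; apply: eq_bigr => x _ /=.
rewrite -big_split; apply: eq_bigr => y _ /=.
by rewrite ffunE -scalerDl !mulrDl.
Qed.

Let mulDr : right_distributive tga_mul +%R.
Proof.
move=> a b c; rewrite /tga_mul -big_split; apply: eq_bigr => x _ /=.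
rewrite -big_split; apply: eq_bigr => y _ /=.
by rewrite ffunE -scalerDl mulrDr mulrDl.
Qed.

Let mulZl k a b : k *: tga_mul a b = tga_mul (k *: a) b.
Proof.
rewrite /tga_mul scaler_sumr; apply: eq_bigr => x _.
rewrite scaler_sumr; apply: eq_bigr => y _.
by rewrite ffunE scalerA !mulrA.
Qed.

Let mulZr k a b : k *: tga_mul a b = tga_mul a (k *: b).
Proof.
rewrite /tga_mul scaler_sumr; apply: eq_bigr => x _.
rewrite scaler_sumr; apply: eq_bigr => y _.
by rewrite ffunE scalerA /GRing.scale /= !mulrA [k * _]mulrC.
Qed.

Let mulu x y : tga_mul (u x) (u y) = fv x y *: u (x * y)%g.
Proof.
rewrite /tga_mul (bigD1 x) //= [X in _ + X]big1 => [|z neq_zx]; last first.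
  by apply: big1 => t _; rewrite !ffunE (negbTE neq_zx) !mul0r scale0r.
rewrite addr0 (bigD1 y) //= big1 => [|z neq_zy]; last first.
  by rewrite !ffunE (negbTE neq_zy) mulr0 mul0r scale0r.
by rewrite !ffunE !eqxx !mul1r addr0.
Qed.

Let mul0 a : tga_mul a 0 = 0.
Proof. by have := mulZr 0 a 0; rewrite !scale0r => <-. Qed.

Let mul0l a : tga_mul 0 a = 0.
Proof. by have := mulZl 0 0 a; rewrite !scale0r => <-. Qed.

Let mul_suml (I : finType) (E : I -> A) b :
  tga_mul (\sum_i E i) b = \sum_i tga_mul (E i) b.
Proof. exact: (big_morph (tga_mul^~ b) (fun a c => mulDl a c b) (mul0l b)). Qed.

Let mul_sumr (I : finType) (E : I -> A) a :
  tga_mul a (\sum_i E i) = \sum_i tga_mul a (E i).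
Proof. exact: (big_morph (tga_mul a) (mulDr a) (mul0 a)). Qed.

Let mulA : associative tga_mul.
Proof.
move: mulZl mulZr mulu mul_suml mul_sumr; move: tga_mul => m mZl mZr mu mSl mSr.
move=> a b c; rewrite (tga_sumE a) !mSl; apply: eq_bigr => x _.
rewrite -!mZl; congr (_ *: _).
rewrite (tga_sumE b) mSl !mSr mSl; apply: eq_bigr => y _.
rewrite -!(mZl, mZr); congr (_ *: _).
rewrite (tga_sumE c) !mSr; apply: eq_bigr => z _.
rewrite -!mZr; congr (_ *: _).
by rewrite !mu -mZl -mZr !mu !scalerA mulgA -fvM.
Qed.

Let mul1 : left_id tga_one tga_mul.
Proof.
move=> a; rewrite [in LHS](tga_sumE a) [RHS]tga_sumE mul_sumr.
apply: eq_bigr => x _; rewrite -mulZr -mulZl mulu mul1g fv1x !scalerA.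
by rewrite -[f 1%g 1%g]/(fv 1%g 1%g) -mulrA mulVf ?mulr1 ?fv_neq0.
Qed.

Let mulr1 : right_id tga_one tga_mul.
Proof.
move=> a; rewrite [in LHS](tga_sumE a) [RHS]tga_sumE mul_suml.
apply: eq_bigr => x _; rewrite -mulZr -mulZl mulu mulg1 fvx1 !scalerA.
by rewrite -[f 1%g 1%g]/(fv 1%g 1%g) mulrAC mulVf ?mul1r ?fv_neq0.
Qed.

Let one_neq0 : tga_one != 0.
Proof.
apply/eqP=> /ffunP/(_ 1%g) /eqP; rewrite !ffunE eqxx.
by rewrite scaler_eq0 oner_eq0 orbF invr_eq0 (negbTE (fv_neq0 1 1)).
Qed.

HB.instance Definition _ :=
  GRing.Zmodule_isNzRing.Build A mulA mul1 mulr1 mulDl mulDr one_neq0.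
HB.instance Definition _ := GRing.Lmodule_isLalgebra.Build F A mulZl.
HB.instance Definition _ := GRing.Lalgebra_isAlgebra.Build F A mulZr.

Lemma tga_basisM x y :
  tga_basis x * tga_basis y = f (sgval x) (sgval y) *: tga_basis (x * y)%g.
Proof. exact: mulu. Qed.

End TwistedGroupAlgebra.

(* The algebra is nonzero, so only matrices of positive size are relevant.    *)
Definition nondegenerate (F : fieldType) (gT : finGroupType) (G : {group gT})
    (f : cocycle2 F G) : Prop :=
  exists (n : nat)
         (phi : {lrmorphism twisted_group_algebra f -> 'M[F]_n.+1}),
    bijective phi.

Definition central_type (F : fieldType) (gT : finGroupType) (G : {group gT}) :
    Prop :=
  exists f : cocycle2 F G, nondegenerate f.

Definition A_type (gT : finGroupType) (G : {group gT}) : Prop :=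
  forall (p : nat) (P : {group gT}), prime p -> p.-Sylow(G) P -> abelian P.

Definition aut_act_cocycle (F : fieldType) (gT : finGroupType)
    (phi : {perm gT}) (f : gT -> gT -> F) : gT -> gT -> F :=
  fun x y => f ((phi^-1)%g x) ((phi^-1)%g y).

(* An action K -> Aut(N) is an eta : groupAction K N; the automorphism by     *)
(* which k \in K acts is actperm eta k \in Aut N.                             *)
Definition symplectic (F : fieldType) (aT gT : finGroupType) (K : {group aT})
    (N : {group gT}) (eta : groupAction K N) : Prop :=
  exists2 f : cocycle2 F N, nondegenerate f &
    {in K, forall k, cohomologous N (aut_act_cocycle (actperm eta k) f) f}.

Definition Weyl_group (gT : finGroupType) (G H : {group gT}) :
    {group coset_of H} := ('N_G(H) / H)%G.

Lemma Weyl_group_acts (gT : finGroupType) (G H : {group gT}) :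
  abelian H -> {acts Weyl_group G H, on group H | 'J %% H}.
Proof.
move=> cHH; split; last by rewrite /= gacentJ.
by rewrite astabs_mod ?astabJ // astabsJ quotientS // subsetIr.
Qed.

(* Conjugation by a representative, as a right action: (gH) maps h to h ^ g,  *)
(* i.e., g^-1 h g. This action of W(H) and the left one, h to g h g^-1, have  *)
(* the same automorphisms, since gH acts on the left as its inverse does on   *)
(* the right.                                                                 *)
Definition Weyl_action (gT : finGroupType) (G H : {group gT})
    (cHH : abelian H) : groupAction (Weyl_group G H) H :=
  <[Weyl_group_acts G cHH]>%gact.

Lemma Weyl_actionE (gT : finGroupType) (G H : {group gT}) (cHH : abelian H) x g :
  x \in H -> g \in 'N_G(H)%g ->
  actperm (Weyl_action G cHH) (coset H g) x = (x ^ g)%g.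
Proof.
move=> Hx Ng; have W_g: coset H g \in Weyl_group G H by rewrite mem_quotient.
rewrite actpermE /= /actby Hx W_g /=.
apply: modactE; [by rewrite inE | by case/setIP: Ng |].
by rewrite setTI afixJ; apply: (subsetP cHH).
Qed.

(* Main.v *)
From HB Require Import structures.
Require Import Defs.
From mathcomp Require Import all_boot all_order all_algebra.
From mathcomp Require Import all_fingroup all_solvable.
From mathcomp Require Import boolp reals complex.
From mathcomp Require Import ring.

(** Write [u_x] for the basis of the twisted group algebra of [f]. If [x] and
[y] commute, then [u_x * u_y] is the multiple [alt_form f x y = f x y / f y x]
of [u_y * u_x], and [x] is called [f]-regular when [alt_form f x] is trivial on
the centraliser of [x]. The predicate [regular_trivial G f] says that [1] is the
only [f]-regular element of [G]. It is equivalent to non-degeneracy. On the one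
hand the sum of the conjugates of [u_x] is central, and not scalar if [x] is
regular and not [1] ([nondegenerate_regular_trivial]). On the other hand, let
[U] be an irreducible projective representation of [G] with cocycle [f], of
degree [n]. By Schur orthogonality the matrices [U x] span the full matrix
algebra, so the twisted algebra is a matrix algebra as soon as [#|G|] divides
[n ^ 2] ([irreducible_nondegenerate]). If [H <= G] has no nontrivial
[f]-regular element, then the character of [U] vanishes on [H] outside [1], so
the commutant of [H] in the matrix algebra has dimension [n ^ 2 / #|H|], and
[#|H|] divides [n ^ 2] ([regular_trivial_dvd]). Applied to the Sylow subgroups
this gives a local criterion: [f] is non-degenerate on [G] if it is so on a
Sylow subgroup for each prime.

Suppose that [G] is of central type. As the Sylow subgroup [P] is abelian, it is
a Sylow subgroup of the centraliser of each of its elements, and it follows that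
an element of [P] which is [f]-regular in [P] is [f]-regular in [G]
([regular_trivial_Sylow]). So [f] restricts to a non-degenerate cocycle on [P],
whose class is invariant under [N_G(P)] because inner automorphisms of [G] fix
the class of [f] ([cohomologous_conj]).

Conversely, a non-degenerate cocycle on [P] with a class invariant under
[N_G(P)] is stable, since the normaliser of an abelian Sylow subgroup controls
its fusion ([abelian_Sylow_fusion]). Its corestriction to [G] then restricts on
[P] to its power of exponent [#|G : P|], up to a coboundary
([corestriction_stable]); this is the stable element theorem, and it is proved
with explicit cochains. As [#|G : P|] is prime to [p], the regular elements of
[P] do not change, while raising to the power [#|G : P|] once more makes
the commutator pairing trivial on the Sylow subgroups for the other primes
([Sylow_cocycle_extension]). The product over all primes of these cocycles meets
the local criterion. *)

Set Implicit Arguments.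
Unset Strict Implicit.
Unset Printing Implicit Defensive.

Import GroupScope GRing.Theory Num.Theory.
Local Open Scope ring_scope.

(** * Cocycles and the commutator pairing *)

Section CocycleIdentities.
Variables (F : fieldType) (gT : finGroupType) (G : {group gT}).
Variable f : gT -> gT -> F.
Hypothesis cocf : is_cocycle2 G f.
Implicit Types x y z : gT.

Lemma cocycle2_neq0 x y : x \in G -> y \in G -> f x y != 0.
Proof. by move=> Gx Gy; apply: cocf.1. Qed.

Lemma cocycle2_eq x y z : x \in G -> y \in G -> z \in G ->
  f x y * f (x * y)%g z = f y z * f x (y * z)%g.
Proof. by move=> *; apply: cocf.2. Qed.

Lemma cocycle2_1l x : x \in G -> f 1%g x = f 1%g 1%g.
Proof.
move=> Gx; have := cocycle2_eq (group1 G) (group1 G) Gx; rewrite !mul1g.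
by move/(mulIf (cocycle2_neq0 (group1 G) Gx)) ->.
Qed.

Lemma cocycle2_1r x : x \in G -> f x 1%g = f 1%g 1%g.
Proof.
move=> Gx; have := cocycle2_eq Gx (group1 G) (group1 G); rewrite !mulg1.
by move/(mulIf (cocycle2_neq0 Gx (group1 G))).
Qed.

(** In the twisted group algebra [u_g^-1 * u_x * u_g] is this multiple of
[u_(x ^ g)]. As conjugation by [u_g] is an automorphism, [f] and its conjugate
by [g] differ by the coboundary of this scalar. *)
Definition conj_scalar g x : F := f x g / f g (x ^ g)%g.

Lemma conj_scalar_neq0 g x : g \in G -> x \in G -> conj_scalar g x != 0.
Proof.
move=> Gg Gx; rewrite /conj_scalar.
by rewrite mulf_neq0 ?invr_eq0 ?cocycle2_neq0 ?groupJ.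
Qed.

Lemma conj_scalarM g x y : g \in G -> x \in G -> y \in G ->
  conj_scalar g x * conj_scalar g y * f (x ^ g)%g (y ^ g)%g
    = f x y * conj_scalar g (x * y)%g.
Proof.
move=> Gg Gx Gy; rewrite /conj_scalar.
have Gxg := groupJ Gx Gg; have Gyg := groupJ Gy Gg.
have e1 := cocycle2_eq Gg Gxg Gyg; have e2 := cocycle2_eq Gx Gg Gyg.
have e3 := cocycle2_eq Gx Gy Gg.
rewrite -conjMg -conjgC in e1; rewrite -conjgC in e2.
have n1 := cocycle2_neq0 Gg Gxg; have n2 := cocycle2_neq0 Gg Gyg.
have n3 := cocycle2_neq0 Gg (groupJ (groupM Gx Gy) Gg).
have n4 := cocycle2_neq0 (groupM Gx Gg) Gyg.
rewrite -[f (x ^ g)%g _](mulfK n3) -e1 -[f x g](mulfK n4) e2 [RHS]mulrA e3.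
by field; rewrite n1 n2 n3 n4.
Qed.

Lemma cohomologous_conj g : g \in G ->
  cohomologous G (fun x y => f (x ^ g)%g (y ^ g)%g) f.
Proof.
move=> Gg; exists (fun x => (conj_scalar g x)^-1) => [x Gx | x y Gx Gy].
  by rewrite invr_eq0 conj_scalar_neq0.
have n1 := conj_scalar_neq0 Gg Gx; have n2 := conj_scalar_neq0 Gg Gy.
rewrite invrK; apply: (mulfI (mulf_neq0 n1 n2)); rewrite conj_scalarM //.
by field; rewrite n1 n2.
Qed.

End CocycleIdentities.

Section AlternatingForm.
Variables (F : fieldType) (gT : finGroupType) (G : {group gT}).

(** On commuting arguments this is the scalar commutator of [u_x] and [u_y],
which depends only on the cohomology class of [f]. *)
Definition alt_form (f : gT -> gT -> F) x y : F := f x y / f y x.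

Variable f : gT -> gT -> F.
Hypothesis cocf : is_cocycle2 G f.
Implicit Types x y z : gT.

Lemma alt_form_eq1 x y : x \in G -> y \in G ->
  (alt_form f x y == 1) = (f x y == f y x).
Proof.
move=> Gx Gy; rewrite /alt_form.
have nz := cocycle2_neq0 cocf Gy Gx.
by rewrite -(inj_eq (mulIf nz)) divfK // mul1r.
Qed.

Lemma alt_formV x y : alt_form f y x = (alt_form f x y)^-1.
Proof. by rewrite /alt_form invf_div. Qed.

(** Conjugation by [u_x] is an automorphism of the twisted group algebra, and
it multiplies [u_y] by [alt_form f x y] for each [y] in the centraliser. *)
Lemma alt_formM x y z : x \in G -> y \in 'C_G[x]%g -> z \in 'C_G[x]%g ->
  alt_form f x (y * z)%g = alt_form f x y * alt_form f x z.
Proof.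
move=> Gx /setIP[Gy /cent1P cxy] /setIP[Gz /cent1P cxz].
have e1 := cocycle2_eq cocf Gx Gy Gz; have e2 := cocycle2_eq cocf Gy Gz Gx.
have e3 := cocycle2_eq cocf Gy Gx Gz; rewrite cxy in e3; rewrite cxz in e2.
have n1 := cocycle2_neq0 cocf Gy Gz; have n2 := cocycle2_neq0 cocf Gz Gx.
have n3 := cocycle2_neq0 cocf Gy Gx.
have n4 := cocycle2_neq0 cocf Gy (groupM Gx Gz).
rewrite /alt_form -[f x (y * z)%g](mulKf n1) -e1 -[f (y * z)%g x](mulKf n1) e2.
rewrite -[f (x * y)%g z](mulKf n3) e3.
by field; rewrite n1 n2 n3 n4.
Qed.

Lemma alt_form1 x : x \in G -> alt_form f x 1%g = 1.
Proof.
move=> Gx; apply/eqP; rewrite alt_form_eq1 ?group1 //.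
by rewrite (cocycle2_1l cocf) // (cocycle2_1r cocf).
Qed.

Lemma alt_formX x y k : x \in G -> y \in 'C_G[x]%g ->
  alt_form f x (y ^+ k)%g = alt_form f x y ^+ k.
Proof.
move=> Gx Cy; elim: k => [|k IHk]; first by rewrite alt_form1.
by rewrite expgS alt_formM ?groupX // IHk exprS.
Qed.

Lemma alt_form_order x y : x \in G -> y \in 'C_G[x]%g ->
  alt_form f x y ^+ #[y]%g = 1.
Proof. by move=> Gx Cy; rewrite -alt_formX // expg_order alt_form1. Qed.

Lemma alt_form_order_l x y : x \in G -> y \in 'C_G[x]%g ->
  alt_form f x y ^+ #[x]%g = 1.
Proof.
move=> Gx /setIP[Gy cxy]; rewrite alt_formV exprVn.
by rewrite alt_form_order ?invr1 // inE Gx cent1C.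
Qed.

Lemma alt_formJ x y c : x \in G -> y \in 'C_G[x]%g -> c \in 'C_G[x]%g ->
  alt_form f x (y ^ c)%g = alt_form f x y.
Proof.
move=> Gx Cy Cc; rewrite conjgE !alt_formM ?groupM ?groupV //.
by rewrite mulrCA -alt_formM ?groupV // mulVg alt_form1 ?mulr1.
Qed.

End AlternatingForm.

Lemma alt_form_cohomologous (F : fieldType) (gT : finGroupType)
    (G : {group gT}) (f1 f2 : gT -> gT -> F) x y :
  is_cocycle2 G f2 -> cohomologous G f1 f2 ->
  x \in G -> y \in G -> commute x y -> alt_form f1 x y = alt_form f2 x y.
Proof.
move=> coc2 [l l0 e] Gx Gy cxy; rewrite /alt_form !e // -cxy.
have n := cocycle2_neq0 coc2 Gy Gx; have nx := l0 x Gx; have ny := l0 y Gy.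
have nxy := l0 _ (groupM Gx Gy).
by field; rewrite n nx ny nxy.
Qed.

(** The elements excluded here are the [f]-regular ones; their classes index a
basis of the centre of the twisted group algebra. *)
Definition regular_trivial (F : fieldType) (gT : finGroupType) (G : {group gT})
    (f : gT -> gT -> F) : Prop :=
  {in G, forall x, {in 'C_G[x]%g, forall y, f x y = f y x} -> x = 1%g}.

Lemma is_cocycle2_sub (F : fieldType) (gT : finGroupType) (H G : {group gT})
    (f : gT -> gT -> F) :
  H \subset G -> is_cocycle2 G f -> is_cocycle2 H f.
Proof.
move=> /subsetP sHG [f0 fM]; split=> [x y /sHG Gx /sHG Gy | x y z].
  exact: f0.
by move=> /sHG Gx /sHG Gy /sHG Gz; apply: fM.
Qed.

Lemma coprime_expr_eq1 (F : fieldType) (a : F) m n :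
  coprime m n -> a ^+ m = 1 -> a ^+ n = 1 -> a = 1.
Proof.
move=> co am an.
have [m0|m_gt0] := posnP m.
  by move: co; rewrite m0 /coprime gcd0n => /eqP n1; rewrite -[a]expr1 -n1.
have [k _] := Bezoutl n m_gt0; rewrite (eqP co) => /(expr_dvd am).
by rewrite exprD expr1 mulnC exprM an expr1n mulr1.
Qed.

(** * Projective representations *)

(** The first clause makes the matrices [U x] invertible: the second one alone
only makes [U 1] a multiple of an idempotent. *)
Definition projective_repr (F : fieldType) (gT : finGroupType) (G : {group gT})
    (f : gT -> gT -> F) n (U : gT -> 'M[F]_n) : Prop :=
  U 1%g = (f 1%g 1%g)%:M /\
  {in G &, forall x y, U x *m U y = f x y *: U (x * y)%g}.

Definition conj_sum (F : fieldType) (gT : finGroupType) (G : {group gT}) n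
    (U : gT -> 'M[F]_n) (X : 'M[F]_n) : 'M[F]_n :=
  \sum_(x in G) U x *m X *m invmx (U x).

Section ProjectiveRepresentation.
Variables (F : fieldType) (gT : finGroupType) (G : {group gT}).
Variable f : gT -> gT -> F.
Hypothesis cocf : is_cocycle2 G f.
Variables (n : nat) (U : gT -> 'M[F]_n).
Hypothesis reprU : projective_repr G f U.
Implicit Types (x y g : gT) (X : 'M[F]_n).

Lemma prepr_unit x : x \in G -> U x \in unitmx.
Proof.
move=> Gx; have Gx' := groupVr Gx; have [U1 UM] := reprU.
have := UM x x^-1%g Gx Gx'; rewrite mulgV U1 => e.
apply: (@mulmx1_unit _ _ _ ((f x x^-1%g * f 1%g 1%g)^-1 *: U x^-1%g) _).1.
rewrite -scalemxAr e scalerA scale_scalar_mx -mulrA mulVf //.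
by rewrite mulf_neq0 ?(cocycle2_neq0 cocf).
Qed.

Lemma prepr_conj g x : g \in G -> x \in G ->
  invmx (U g) *m U x *m U g = conj_scalar f g x *: U (x ^ g)%g.
Proof.
move=> Gg Gx; have [_ UM] := reprU; have Gxg := groupJ Gx Gg.
apply: (can_inj (mulKmx (prepr_unit Gg))).
rewrite -scalemxAr UM // -conjgC -mulmxA mulKVmx ?prepr_unit // UM //.
by rewrite scalerA /conj_scalar divfK ?(cocycle2_neq0 cocf).
Qed.

Lemma prepr_conjV g x : g \in G -> x \in G ->
  U g *m U x *m invmx (U g)
    = (conj_scalar f g (x ^ g^-1)%g)^-1 *: U (x ^ g^-1)%g.
Proof.
move=> Gg Gx; have Gy : (x ^ g^-1)%g \in G by rewrite groupJ ?groupV.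
have := prepr_conj Gg Gy; rewrite conjgKV => e.
have nz := conj_scalar_neq0 cocf Gg Gy.
have -> : U x = (conj_scalar f g (x ^ g^-1)%g)^-1
   *: (invmx (U g) *m U (x ^ g^-1)%g *m U g).
  by rewrite e scalerA mulVf ?scale1r.
rewrite -scalemxAr -scalemxAl -!mulmxA mulKVmx ?prepr_unit //.
by rewrite mulmxV ?prepr_unit // mulmx1.
Qed.

(** If [y] commutes with [x] but [u_y] does not commute with [u_x], then
conjugation by [u_y] multiplies [u_x] by a scalar other than [1], and the trace
of [u_x] is unchanged. *)
Lemma mxtrace_prepr0 x y : x \in G -> y \in 'C_G[x]%g -> f x y != f y x ->
  \tr (U x) = 0.
Proof.
move=> Gx /setIP[Gy /cent1P cxy] ne; have := prepr_conj Gy Gx.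
have -> : (x ^ y)%g = x by rewrite /conjg -cxy mulKg.
move/(congr1 mxtrace); rewrite mxtraceZ mxtrace_mulC mulmxA.
rewrite mulmxV ?prepr_unit // mul1mx /conj_scalar => /eqP.
have -> : (x ^ y)%g = x by rewrite /conjg -cxy mulKg.
rewrite -subr_eq0 -{1}[\tr _]mul1r -mulrBl mulf_eq0 => /orP[|/eqP //].
rewrite subr_eq0 eq_sym -/(alt_form f x y) (alt_form_eq1 cocf) //.
by rewrite (negbTE ne).
Qed.

(** Each summand over [G] is moved to the summand over [g * x], because the
scalar relating [u_g * u_x] to [u_(g * x)] cancels in the conjugation. *)
Lemma conj_sum_comm X g : g \in G ->
  U g *m conj_sum G U X = conj_sum G U X *m U g.
Proof.
move=> Gg; have [_ UM] := reprU.
rewrite /conj_sum mulmx_sumr mulmx_suml.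
rewrite [RHS](reindex_inj (mulgI g)) /=; apply: eq_big => [x|x Gx].
  by rewrite groupMl.
apply: (can_inj (mulmxK (prepr_unit Gx))).
rewrite -[RHS]mulmxA UM // -scalemxAr mulmxKV ?prepr_unit ?groupM //.
by rewrite !mulmxA mulmxKV ?prepr_unit // UM // scalemxAl.
Qed.

Lemma conj_sum_fixed X :
  {in G, forall x, U x *m X = X *m U x} -> conj_sum G U X = X *+ #|G|.
Proof.
move=> cUX; rewrite /conj_sum (eq_bigr (fun=> X)) ?sumr_const // => x Gx.
by rewrite cUX // mulmxK ?prepr_unit.
Qed.

Lemma mxtrace_conj_sum X : \tr (conj_sum G U X) = \tr X *+ #|G|.
Proof.
rewrite /conj_sum raddf_sum /= (eq_bigr (fun=> \tr X)) ?sumr_const // => x Gx.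
by rewrite mxtrace_mulC mulKmx ?prepr_unit.
Qed.

End ProjectiveRepresentation.

(** Right multiplication by the [u_x] on the twisted group algebra. *)
Definition regular_prepr (F : fieldType) (gT : finGroupType) (G : {group gT})
    (f : gT -> gT -> F) (x : gT) : 'M[F]_#|G| :=
  \matrix_(i, j) (f (enum_val i) x *+ (enum_val j == enum_val i * x)%g).

Lemma regular_preprP (F : fieldType) (gT : finGroupType) (G : {group gT})
    (f : gT -> gT -> F) :
  is_cocycle2 G f -> projective_repr G f (regular_prepr G f).
Proof.
move=> cocf; split=> [|x y Gx Gy]; apply/matrixP=> i j; rewrite !mxE.
  rewrite mulg1 (cocycle2_1r cocf) ?enum_valP // (inj_eq enum_val_inj).
  by rewrite eq_sym.
have Gi := enum_valP i; have Gix := groupM Gi Gx.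
rewrite (bigD1 (enum_rank_in Gix (enum_val i * x)%g)) //= !mxE.
rewrite enum_rankK_in // eqxx mulr1n big1 ?addr0 => [|k ne].
  by rewrite !mulrnAr -mulgA (cocycle2_eq cocf).
rewrite !mxE; case: eqP => [e|_]; last by rewrite mulr0n mul0r.
by case/eqP: ne; apply: enum_val_inj; rewrite enum_rankK_in.
Qed.

(** By Schur's lemma a projective representation over an algebraically closed
field is irreducible exactly when it satisfies this condition. *)
Definition schur_irreducible (F : fieldType) (gT : finGroupType)
    (G : {group gT}) n (U : gT -> 'M[F]_n) : Prop :=
  forall X, {in G, forall x, U x *m X = X *m U x} -> is_scalar_mx X.

(** When a non-scalar matrix commutes with the [u_x], each of its eigenspaces
affords a representation of smaller positive degree. *)
Lemma exists_smaller_prepr (C : numClosedFieldType) (gT : finGroupType)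
    (G : {group gT}) (f : gT -> gT -> C) n (U : gT -> 'M[C]_n) X :
  (0 < n)%N -> projective_repr G f U ->
  {in G, forall x, U x *m X = X *m U x} -> ~~ is_scalar_mx X ->
  exists m, (0 < m < n)%N /\
    exists V : gT -> 'M[C]_m, projective_repr G f V.
Proof.
move=> n_gt0 [U1 UM] cUX nsX; have [a eig_a] := eigenvalue_closed X n_gt0.
pose E := eigenspace X a; pose B := row_base E.
have freeB : row_free B by apply: row_base_free.
exists (\rank E); split.
  rewrite lt0n mxrank_eq0 -[E != 0]/(eigenvalue X a) eig_a.
  rewrite ltn_neqAle rank_leq_row andbT.
  apply: contra nsX => /eqP fullE; apply/is_scalar_mxP; exists a.
  have : (1%:M <= E)%MS by rewrite sub1mx -col_leq_rank fullE.
  by move/eigenspaceP; rewrite mul1mx scalemx1.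
pose V x := B *m U x *m pinvmx B; exists V.
have VB x : x \in G -> V x *m B = B *m U x.
  move=> Gx; rewrite /V mulmxKpV // eq_row_base.
  apply/eigenspaceP; rewrite -mulmxA cUX // mulmxA.
  suff /eigenspaceP -> : (B <= E)%MS by rewrite scalemxAl.
  by rewrite eq_row_base.
split=> [|x y Gx Gy]; apply: (row_free_inj freeB).
  by rewrite VB ?group1 // U1 mul_mx_scalar mul_scalar_mx.
rewrite -mulmxA VB // mulmxA VB // -mulmxA UM // -scalemxAr -scalemxAl.
by rewrite VB ?groupM.
Qed.

Lemma exists_irreducible_prepr (C : numClosedFieldType) (gT : finGroupType)
    (G : {group gT}) (f : gT -> gT -> C) :
  is_cocycle2 G f ->
  exists n (U : gT -> 'M[C]_n.+1),
    projective_repr G f U /\ schur_irreducible G U.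
Proof.
move=> cocf; move: (cardG_gt0 G) (regular_preprP cocf).
move: #|G| (regular_prepr G f).
elim/ltn_ind=> n IHn U n_gt0 reprU.
have [irrU|] := EM (schur_irreducible G U).
  by case: n n_gt0 {IHn} U reprU irrU => // n _ U reprU irrU; exists n, U.
rewrite /schur_irreducible => /existsNP[X /not_implyP[cUX /negP nsX]].
have [m [/andP[m_gt0 ltmn] [V reprV]]] :=
  exists_smaller_prepr n_gt0 reprU cUX nsX.
exact: IHn reprV.
Qed.

Lemma central_mx_scalar (R : pzRingType) n (Z : 'M[R]_n.+1) :
  (forall X, X *m Z = Z *m X) -> Z = (Z 0 0)%:M.
Proof.
move=> cZ; apply/matrixP=> k i.
have := congr1 (fun M : 'M[R]_n.+1 => M k 0) (cZ (delta_mx i 0)).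
rewrite !mxE (bigD1 0) //= big1 => [|j ne]; last first.
  by rewrite mxE eq_sym (negbTE ne) andbF mul0r.
rewrite (bigD1 i) //= big1 => [|j ne]; last first.
  by rewrite mxE (negbTE ne) mulr0.
by rewrite !mxE !eqxx !addr0 andbT mulr1 mulr_natl => ->.
Qed.

(** * Non-degeneracy excludes regular elements *)

Section NondegenerateRegular.
Variables (F : numFieldType) (gT : finGroupType) (G : {group gT}).
Variable f : cocycle2 F G.

Lemma tga_basis1 : tga_basis f 1%g = f 1%g 1%g *: 1.
Proof.
rewrite /GRing.one /= /tga_one scalerA mulfV ?scale1r //.
exact: (cocycle2_neq0 (cocycle2P f)).
Qed.

Lemma lrmorphism_prepr n
    (phi : {lrmorphism twisted_group_algebra f -> 'M[F]_n.+1}) :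
  projective_repr G f (fun x => phi (tga_basis f (subg G x))).
Proof.
split=> [|x y Gx Gy].
  by rewrite morph1 tga_basis1 linearZ /= rmorph1 scalemx1.
by rewrite -[LHS]rmorphM /= tga_basisM linearZ /= !subgK // subgM.
Qed.

(** Were [x] regular and not [1], the sum of the conjugates of [u_x] would be a
central element, hence a scalar, with the nonzero coefficient [#|'C_G[x]|] on
[u_x]. *)
Lemma nondegenerate_regular_trivial :
  Defs.nondegenerate f -> regular_trivial G f.
Proof.
have cocf := cocycle2P f.
move=> [n [phi [psi phiK psiK]]] x Gx regx; apply: contrapT => /eqP ntx.
pose U y : 'M_n.+1 := phi (tga_basis f (subg G y)).
have reprU : projective_repr G f U := lrmorphism_prepr phi.
pose Z := conj_sum G U (U x).
have commE W :
    (forall y, phi (tga_basis f y) *m W = W *m phi (tga_basis f y)) ->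
    forall X, X *m W = W *m X.
  move=> cW X; rewrite -[X]psiK [psi X]tga_sumE (raddf_sum phi) mulmx_suml.
  rewrite mulmx_sumr; apply: eq_bigr => y _.
  by rewrite /= linearZ -scalemxAl -scalemxAr cW.
have cZ : forall X, X *m Z = Z *m X.
  apply: commE => y; rewrite -[y]sgvalK -[phi _]/(U (sgval y)).
  exact: (conj_sum_comm cocf reprU _ (subgP y)).
pose k y := (conj_scalar f y (x ^ y^-1)%g)^-1.
have EZ : phi (\sum_(y in G) k y *: tga_basis f (subg G (x ^ y^-1)%g))
        = phi (Z 0 0 *: 1).
  rewrite [RHS]linearZ /= rmorph1 scalemx1 -central_mx_scalar // linear_sum.
  apply: eq_bigr => y Gy; rewrite linearZ /=.
  by rewrite (prepr_conjV cocf reprU Gy Gx).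
have := congr1 (fun a : {ffun subg_of G -> F^o} => a (subg G x))
  (can_inj phiK EZ).
rewrite /= sum_ffunE /GRing.one /= /tga_one !ffunE.
have -> : (subg G x == 1%g) = false.
  by apply: contraNF ntx => /eqP/(congr1 sgval); rewrite subgK //= => ->.
rewrite !scaler0 (eq_bigr (fun y => ((x ^ y^-1)%g == x)%:R)) => [|y Gy];
  last first.
  rewrite !ffunE -(inj_eq val_inj) /= !subgK ?groupJ ?groupV // eq_sym.
  case: eqP => [fix_x|_]; last by rewrite scaler0.
  have fix_xy : (x ^ y)%g = x by rewrite -{1}fix_x conjgKV.
  have Cy : y \in 'C_G[x]%g.
    by rewrite inE Gy; apply/cent1P/commute_sym; rewrite /commute conjgC fix_xy.
  rewrite /k fix_x /conj_scalar fix_xy regx // divff ?invr1 //.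
    exact: mulr1.
  exact: (cocycle2_neq0 cocf).
apply/eqP; rewrite -natr_sum pnatr_eq0 sum_nat_eq0.
by apply/forallPn; exists 1%g; rewrite group1 invg1 conjg1 eqxx.
Qed.

End NondegenerateRegular.

(** * Schur orthogonality *)

Section Irreducible.
Variables (F : numFieldType) (gT : finGroupType) (G : {group gT}).
Variable f : gT -> gT -> F.
Hypothesis cocf : is_cocycle2 G f.
Variables (n : nat) (U : gT -> 'M[F]_n.+1).
Hypothesis reprU : projective_repr G f U.
Hypothesis irrU : schur_irreducible G U.

(** The sum commutes with every [U x], so it is scalar by irreducibility, and
conjugation preserves the trace. *)
Lemma irr_conj_sum X : conj_sum G U X = (\tr X * (#|G|%:R / n.+1%:R))%:M.
Proof.
have /is_scalar_mxP[c e] : is_scalar_mx (conj_sum G U X).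
  by apply: irrU => x Gx; apply: (conj_sum_comm cocf reprU).
rewrite e; congr _%:M; have := mxtrace_conj_sum cocf reprU X.
rewrite e mxtrace_scalar -[c *+ _]mulr_natr -[\tr X *+ _]mulr_natr => ec.
by rewrite mulrA -ec mulfK // pnatr_eq0.
Qed.

(** This is the Fourier inversion that follows from Schur orthogonality. It
exhibits the matrices [U g] as a spanning set, as in Burnside's theorem. *)
Lemma irr_inversion X :
  X = \sum_(g in G) (n.+1%:R / #|G|%:R * \tr (X *m invmx (U g))) *: U g.
Proof.
apply/matrixP=> k i; rewrite summxE.
have nzG : #|G|%:R != 0 :> F by rewrite pnatr_eq0 -lt0n.
have nzn : n.+1%:R != 0 :> F by rewrite pnatr_eq0.
have trE l j : \tr (delta_mx j l : 'M[F]_n.+1) = (j == l)%:R.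
  rewrite /mxtrace (bigD1 j) //= big1 => [|a /negbTE ne]; last first.
    by rewrite mxE ne.
  by rewrite mxE eqxx addr0.
transitivity (n.+1%:R / #|G|%:R *
    \sum_l \sum_j X l j * conj_sum G U (delta_mx i j) k l).
  rewrite (bigD1 k) //= [Y in _ + Y]big1 => [|l ne]; last first.
    rewrite big1 // => j _; rewrite irr_conj_sum mxE eq_sym (negbTE ne).
    by rewrite mulr0n mulr0.
  rewrite (bigD1 i) //= big1 => [|j ne]; last first.
    by rewrite irr_conj_sum mxE trE eq_sym (negbTE ne) mul0r mul0rn mulr0.
  rewrite irr_conj_sum mxE !eqxx trE eqxx !mulr1n !addr0 mul1r.
  by rewrite mulrCA -[n.+1%:R / _]invf_div mulVf ?mulr1 // mulf_neq0 ?invr_eq0.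
have deltaE (A B : 'M[F]_n.+1) l j :
    (A *m delta_mx i j *m B) k l = A k i * B j l.
  rewrite mxE (bigD1 j) //= big1 => [|a ne]; last first.
    rewrite mxE big1 ?mul0r // => b _.
    by rewrite mxE (negbTE ne) andbF mulr0.
  rewrite addr0 mxE (bigD1 i) //= big1 => [|b ne]; last first.
    by rewrite mxE (negbTE ne) mulr0.
  by rewrite mxE !eqxx mulr1 addr0.
rewrite [in RHS](eq_bigr (fun g => n.+1%:R / #|G|%:R *
   \sum_l \sum_j X l j * (U g *m delta_mx i j *m invmx (U g)) k l)).
  rewrite -mulr_sumr [in RHS]exchange_big; congr (_ * _).
  apply: eq_bigr => l _ /=.
  rewrite [RHS]exchange_big; apply: eq_bigr => j _ /=.
  by rewrite /conj_sum summxE mulr_sumr.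
move=> g _; rewrite mxE -mulrA; congr (_ * _).
rewrite /mxtrace mulr_suml; apply: eq_bigr => l _.
rewrite mxE mulr_suml; apply: eq_bigr => j _.
by rewrite deltaE -mulrA [invmx _ _ _ * _]mulrC.
Qed.

End Irreducible.

(** * Character computations and the divisibility criterion *)

(** In a rank factorisation [E = A *m B] of an idempotent, [B *m A] is the
identity of size [\rank E], and it has the trace of [E]. *)
Lemma mxtrace_idempotent (F : fieldType) n (E : 'M[F]_n) :
  E *m E = E -> \tr E = (\rank E)%:R.
Proof.
move=> idE; have := mulmx_base E; have := row_base_free E.
have := col_base_full E; move: (col_base E) (row_base E) => A B.
move=> fullA freeB defE.
suff BA1 : B *m A = 1%:M by rewrite -{1}defE mxtrace_mulC BA1 mxtrace1.
apply: (row_free_inj freeB); apply: (row_full_inj fullA).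
by rewrite mul1mx !mulmxA defE -mulmxA defE.
Qed.

(** [X |-> A *m X *m B] is the tensor product of [A] and the transpose of [B].
*)
Lemma mxtrace_lin_conj (F : fieldType) n (A B : 'M[F]_n) :
  \tr (lin_mulmx A *m lin_mulmxr B) = \tr A * \tr B.
Proof.
(* Rows and columns of [M] are indexed by pairs, through [mxvec_index]. *)
have tr_pair (M : 'M[F]_(n * n)) :
    \tr M = \sum_i \sum_j M (mxvec_index i j) (mxvec_index i j).
  rewrite /mxtrace pair_bigA /=.
  by rewrite (reindex _ (curry_mxvec_bij n n)); apply: eq_bigr => -[i j].
rewrite tr_pair mulr_suml; apply: eq_bigr => i _; rewrite mulr_sumr.
apply: eq_bigr => j _.
have -> (M : 'M[F]_(n * n)) : M (mxvec_index i j) (mxvec_index i j)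
   = (mxvec (delta_mx i j) *m M) 0 (mxvec_index i j) :> F.
  by rewrite mxvec_delta -rowE mxE.
rewrite mulmxA !mul_vec_lin mxvecE /= mxE.
rewrite (bigD1 j) //= big1 => [|k ne]; last first.
  by rewrite mxE big1 ?mul0r // => l _; rewrite mxE (negbTE ne) andbF mulr0.
rewrite addr0 mxE (bigD1 i) //= big1 => [|l ne]; last first.
  by rewrite mxE (negbTE ne) mulr0.
by rewrite mxE !eqxx mulr1 addr0.
Qed.

(** The commutant of the matrices [U x] is the image of an idempotent, the
averaged conjugation, whose trace is computed from the character
[x |-> \tr (U x)]. The character is concentrated at [1], so the dimension of
the commutant is [n ^ 2 / #|H|]. *)
Lemma regular_trivial_dvd (F : numFieldType) (gT : finGroupType)
    (H : {group gT}) (f : gT -> gT -> F) n (U : gT -> 'M[F]_n) :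
  is_cocycle2 H f -> projective_repr H f U -> regular_trivial H f ->
  (#|H| %| n ^ 2)%N.
Proof.
move=> cocf reprU regH.
have tr0 x : x \in H -> x != 1%g -> \tr (U x) = 0.
  move=> Hx ntx.
  have [fC|/existsNP[y]] := EM {in 'C_H[x]%g, forall y, f x y = f y x}.
    by case/eqP: ntx; apply: regH.
  by case/not_implyP=> Cy /eqP ne; apply: (mxtrace_prepr0 cocf reprU Hx Cy ne).
have nzH : #|H|%:R != 0 :> F by rewrite pnatr_eq0 -lt0n.
pose T := \sum_(x in H) lin_mulmx (U x) *m lin_mulmxr (invmx (U x)).
have TE X : mxvec X *m T = mxvec (conj_sum H U X).
  rewrite mulmx_sumr /conj_sum [RHS]linear_sum; apply: eq_bigr => x _.
  by rewrite mulmxA !mul_vec_lin.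
have TT : T *m T = #|H|%:R *: T.
  apply/row_matrixP=> i; rewrite !rowE -[delta_mx 0 i]vec_mxK mulmxA.
  rewrite -scalemxAr !TE (conj_sum_fixed cocf reprU) => [|x Hx]; last first.
    exact: (conj_sum_comm cocf reprU).
  by rewrite linearMn scaler_nat.
have idE : (#|H|%:R^-1 *: T) *m (#|H|%:R^-1 *: T) = #|H|%:R^-1 *: T.
  by rewrite -scalemxAl -scalemxAr TT !scalerA mulfVK.
have [U1 _] := reprU; have f11 := cocycle2_neq0 cocf (group1 H) (group1 H).
have trT : \tr T = (n ^ 2)%:R.
  rewrite raddf_sum /= (bigD1 1%g) //= big1 => [|x /andP[Hx ntx]]; last first.
    by rewrite mxtrace_lin_conj tr0 ?mul0r.
  rewrite addr0 mxtrace_lin_conj U1 invmx_scalar !mxtrace_scalar.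
  rewrite -[f _ _ *+ n]mulr_natl -[_^-1 *+ n]mulr_natl mulrACA mulfV // mulr1.
  by rewrite -natrM mulnn.
have := mxtrace_idempotent idE; rewrite mxtraceZ trT => e.
apply/dvdnP; exists (\rank (#|H|%:R^-1 *: T)); apply/eqP.
by rewrite -(eqr_nat F) natrM -e mulrAC mulVf ?mul1r.
Qed.

Lemma sum_subg (gT : finGroupType) (G : {group gT}) (V : nmodType)
    (E : gT -> V) :
  \sum_(x in G) E x = \sum_(x : subg_of G) E (sgval x).
Proof.
rewrite (reindex_onto sgval (subg G)) => [|x Gx]; last exact: subgK.
by apply: eq_bigl => x; rewrite subgP sgvalK eqxx.
Qed.

(** * The twisted group algebra acting through a representation *)

Section NondegenerateOfIrreducible.
Variables (F : numFieldType) (gT : finGroupType) (G : {group gT}).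
Variable f : cocycle2 F G.
Variables (n : nat) (U : gT -> 'M[F]_n.+1).
Hypothesis reprU : projective_repr G f U.

Definition repr_alg (a : twisted_group_algebra f) : 'M[F]_n.+1 :=
  \sum_x a x *: U (sgval x).

Lemma repr_alg_is_linear : linear repr_alg.
Proof.
move=> k a b; rewrite /repr_alg scaler_sumr -big_split.
apply: eq_bigr => x _ /=.
by rewrite !ffunE scalerA scalerDl.
Qed.

HB.instance Definition _ :=
  GRing.isLinear.Build F (twisted_group_algebra f) 'M[F]_n.+1 _ repr_alg
    repr_alg_is_linear.

Lemma repr_alg_basis x : repr_alg (tga_basis f x) = U (sgval x).
Proof.
rewrite /repr_alg (bigD1 x) //= big1 => [|y ne].
  by rewrite ffunE eqxx scale1r addr0.
by rewrite ffunE (negbTE ne) scale0r.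
Qed.

Lemma repr_alg_is_monoid_morphism : monoid_morphism repr_alg.
Proof.
have [U1 UM] := reprU.
have f11 := cocycle2_neq0 (cocycle2P f) (group1 G) (group1 G).
split=> [|a b].
  rewrite /GRing.one /= /tga_one linearZ /= repr_alg_basis U1.
  by rewrite scale_scalar_mx mulVf.
rewrite (tga_sumE a) mulr_suml !linear_sum mulr_suml; apply: eq_bigr => x _.
rewrite (tga_sumE b) mulr_sumr !linear_sum mulr_sumr; apply: eq_bigr => y _.
rewrite -scalerAl -scalerAr tga_basisM !linearZ /= !repr_alg_basis.
rewrite -scalerAl -scalerAr; congr (_ *: (_ *: _)).
by rewrite -UM ?subgP // sgvalM.
Qed.

HB.instance Definition _ :=
  GRing.isMonoidMorphism.Build (twisted_group_algebra f) 'M[F]_n.+1 repr_alg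
    repr_alg_is_monoid_morphism.

(** The matrices [U x] span by Fourier inversion, so [n.+1 ^ 2 <= #|G|]; with
the divisibility the two are equal, and the spanning matrices are independent.
*)
Lemma irreducible_nondegenerate :
  schur_irreducible G U -> (#|G| %| n.+1 ^ 2)%N -> Defs.nondegenerate f.
Proof.
move=> irrU dvdG; have cocf := cocycle2P f.
pose M := \matrix_(i < #|G|) mxvec (U (enum_val i)).
have freeM : row_free M.
  have fullM : row_full M.
    rewrite -sub1mx; apply/row_subP=> i; rewrite row1 -[delta_mx 0 i]vec_mxK.
    rewrite [vec_mx _](irr_inversion cocf reprU irrU) linear_sum.
    apply: summx_sub => g Gg; rewrite linearZ scalemx_sub //.
    by have := row_sub (enum_rank_in Gg g) M; rewrite rowK enum_rankK_in.
  rewrite -row_leq_rank (eqP fullM) mulnn; exact: dvdn_leq.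
have inj0 a : repr_alg a = 0 -> a = 0.
  move=> a0; pose v : 'rV_#|G| := \row_i a (subg G (enum_val i)).
  have v0 : v = 0.
    apply: (row_free_inj freeM); rewrite mul0mx mulmx_sum_row.
    transitivity (mxvec (\sum_(x in G) a (subg G x) *: U x)).
      rewrite [RHS]linear_sum [RHS]big_enum_val; apply: eq_bigr => i _.
      by rewrite [RHS]linearZ /= rowK mxE.
    apply: etrans (linear0 mxvec); congr (mxvec _); rewrite sum_subg -[RHS]a0.
    by apply: eq_bigr => x _; rewrite sgvalK.
  apply/ffunP=> x.
  have := congr1 (fun w : 'rV_ _ => w 0 (enum_rank_in (subgP x) (sgval x))) v0.
  by rewrite !mxE enum_rankK_in ?subgP // sgvalK ffunE.
pose psi (X : 'M[F]_n.+1) : twisted_group_algebra f :=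
  [ffun x => n.+1%:R / #|G|%:R * \tr (X *m invmx (U (sgval x)))].
have psiK : cancel psi repr_alg.
  move=> X; rewrite [RHS](irr_inversion cocf reprU irrU) sum_subg.
  by apply: eq_bigr => x _; rewrite ffunE.
exists n, repr_alg; exists psi => // a.
by apply/eqP; rewrite -subr_eq0; apply/eqP/inj0; rewrite linearB /= psiK subrr.
Qed.

End NondegenerateOfIrreducible.

(** * The local criterion *)

(** The degree of an irreducible representation has a square divisible by the
order of each Sylow subgroup, hence by the order of [G]. *)
Lemma Sylow_regular_trivial_nondegenerate (C : numClosedFieldType)
    (gT : finGroupType) (G : {group gT}) (f : cocycle2 C G) :
  (forall p, prime p ->
     exists2 P : {group gT}, (p.-Sylow(G) P)%g & regular_trivial P f) ->
  Defs.nondegenerate f.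
Proof.
move=> regS; have cocf := cocycle2P f.
have [n [U [reprU irrU]]] := exists_irreducible_prepr cocf.
apply: (irreducible_nondegenerate reprU irrU).
apply/dvdn_partP=> // p; rewrite mem_primes => /andP[p_pr _].
have [P sylP regP] := regS p p_pr; rewrite -(card_Hall sylP).
have sPG := pHall_sub sylP; have [U1 UM] := reprU.
have reprP : projective_repr P f U.
  by split=> // x y Px Py; apply: UM; apply: (subsetP sPG).
exact: regular_trivial_dvd (is_cocycle2_sub sPG cocf) reprP regP.
Qed.

Lemma regular_trivial_nondegenerate (C : numClosedFieldType)
    (gT : finGroupType) (G : {group gT}) (f : cocycle2 C G) :
  regular_trivial G f -> Defs.nondegenerate f.
Proof.
move=> regG; have cocf := cocycle2P f.
have [n [U [reprU irrU]]] := exists_irreducible_prepr cocf.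
apply: (irreducible_nondegenerate reprU irrU).
exact: regular_trivial_dvd cocf reprU regG.
Qed.

(** A [p]-element [x] of [P] that commutes in the twisted algebra with the
[u_y], [y] in [P], does so with every [u_y], [y] in [C_G(x)]: the [p']-part of
[y] contributes a scalar whose order is prime to [p] and divides [#[x]], and
its [p]-part is conjugate in [C_G(x)] to an element of [P]. *)
Lemma regular_trivial_Sylow (F : fieldType) (gT : finGroupType)
    (G P : {group gT}) (f : gT -> gT -> F) p :
  is_cocycle2 G f -> (p.-Sylow(G) P)%g -> abelian P ->
  regular_trivial G f -> regular_trivial P f.
Proof.
move=> cocf sylP abP regG x Px regx; have sPG := pHall_sub sylP.
have Gx := subsetP sPG x Px; apply: (regG x Gx) => y Cy.
have [Gy _] := setIP Cy.
apply/eqP; rewrite -(alt_form_eq1 cocf) //; apply/eqP.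
have Cp : (y.`_p)%g \in 'C_G[x]%g by rewrite groupX.
have Cp' : (y.`_p^')%g \in 'C_G[x]%g by rewrite groupX.
have sPC : P \subset 'C_G[x]%g.
  by rewrite subsetI sPG sub_cent1 (subsetP abP).
rewrite -[y](consttC p) (alt_formM cocf) //.
have -> : alt_form f x (y.`_p^')%g = 1.
  have op := alt_form_order_l cocf Gx Cp'.
  have oq := alt_form_order cocf Gx Cp'.
  apply: coprime_expr_eq1 op oq.
  exact: pnat_coprime (mem_p_elt (pHall_pgroup sylP) Px) (p_elt_constt _ _).
rewrite mulr1.
have sylPC := pHall_subl sPC (subsetIl _ _) sylP.
have sYC : <[y.`_p]>%g \subset 'C_G[x]%g by rewrite cycle_subG.
have [c Cc sc] := Sylow_Jsub sylPC sYC (p_elt_constt _ _).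
rewrite -(alt_formJ cocf Gx Cp Cc).
have Pc : (y.`_p ^ c)%g \in P.
  by apply: (subsetP sc); rewrite memJ_conjg cycle_id.
apply/eqP; rewrite (alt_form_eq1 cocf) ?(subsetP sPG) //; apply/eqP/regx.
by rewrite inE Pc; apply/cent1P; apply: (centsP abP).
Qed.

(** * Corestriction *)

Section Corestriction.
Variables (F : fieldType) (gT : finGroupType) (G P : {group gT}).
Variable f : gT -> gT -> F.
Hypothesis cocf : is_cocycle2 P f.
Variable t : {set gT} -> gT.
Hypothesis tP : {in rcosets P G, forall X, t X \in X}.
Implicit Types (g h : gT) (X : {set gT}).

Definition transversal_cocycle X g : gT := (t X * g * (t (X :* g))^-1)%g.
Local Notation a := transversal_cocycle.

(** The cocycle of the tensor induction to [G] of a projective representation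
of [P] with cocycle [f]. *)
Definition corestriction g h : F :=
  \prod_(X in rcosets P G) f (a X g) (a (X :* g)%g h).

Lemma mem_rcosetsM X g : g \in G ->
  ((X :* g)%g \in rcosets P G) = (X \in rcosets P G).
Proof.
move=> Gg; apply/rcosetsP/rcosetsP=> [[h Gh e] | [h Gh ->]].
  exists (h * g^-1)%g; first by rewrite groupM ?groupV.
  by rewrite rcosetM -e -rcosetM mulgV mulg1.
by exists (h * g)%g; rewrite ?groupM // rcosetM.
Qed.

Lemma prod_rcosetsM (E : {set gT} -> F) g : g \in G ->
  \prod_(X in rcosets P G) E (X :* g)%g = \prod_(X in rcosets P G) E X.
Proof.
move=> Gg; rewrite [RHS](reindex_inj (can_inj (rcosetK g))) /=.
by apply: eq_bigl => X; rewrite mem_rcosetsM.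
Qed.

Lemma transversal_cocycle_mem X g : X \in rcosets P G -> g \in G -> a X g \in P.
Proof.
move=> PX Gg; rewrite -mem_rcoset.
have := tP PX; have := tP (etrans (mem_rcosetsM X Gg) PX).
have /rcosetsP[h Gh ->] := PX; rewrite -rcosetM => tg th.
rewrite (rcoset_eqP tg).
by rewrite rcosetM mem_rcoset mulgK.
Qed.

Lemma transversal_cocycleM X g h : (a X g * a (X :* g)%g h = a X (g * h))%g.
Proof. by rewrite /a rcosetM !mulgA mulgKV. Qed.

Lemma corestrictionP : is_cocycle2 G corestriction.
Proof.
split=> [x y Gx Gy|x y z Gx Gy Gz].
  apply/prodf_neq0 => X PX; apply: (cocycle2_neq0 cocf).
    exact: transversal_cocycle_mem.
  by apply: transversal_cocycle_mem; rewrite // mem_rcosetsM.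
rewrite /corestriction -(prod_rcosetsM (fun X => f (a X y) _) Gx) -!big_split.
apply: eq_bigr => X PX /=; rewrite -rcosetM -!transversal_cocycleM rcosetM.
by rewrite (cocycle2_eq cocf) ?transversal_cocycle_mem ?mem_rcosetsM.
Qed.

End Corestriction.

(** * Stable cocycles *)

(** The representative [r X * s X] of [X] has a first factor that depends only
on the double coset [X * P]. Along an orbit of [P] on the cosets, conjugation by
[r X] is then one and the same isomorphism, and only [s X] varies in [P]. *)
Lemma double_coset_transversal (gT : finGroupType) (G P : {group gT}) :
  P \subset G ->
  exists r s : {set gT} -> gT, {in rcosets P G, forall X,
    [/\ r X \in G, s X \in P, (r X * s X)%g \in X &
        {in P, forall x, r (X :* x)%g = r X}]}.
Proof.
move=> sPG; pose r (X : {set gT}) := repr (X * P)%g.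
pose s (X : {set gT}) := repr (P :&: ((r X)^-1 *: X))%g.
exists r, s => X /rcosetsP[h Gh defX].
have sXG : X \subset G by rewrite defX mul_subG ?sub1set.
have : r X \in (X * P)%g.
  apply: (@mem_repr _ _ (h * 1)%g).
  by rewrite mem_mulg ?group1 // defX rcoset_refl.
case/mulsgP=> u v Xu Pv defr.
have : s X \in (P :&: ((r X)^-1 *: X))%g.
  apply: (@mem_repr _ _ v^-1%g); rewrite inE groupV Pv mem_lcoset invgK defr.
  by rewrite mulgK.
rewrite inE mem_lcoset invgK => /andP[Ps Xrs]; split=> // [|x Px].
  by rewrite defr groupM ?(subsetP sXG u) ?(subsetP sPG v).
by rewrite /r -mulgA (lcoset_id Px).
Qed.

Section StableElements.
Variables (F : fieldType) (gT : finGroupType) (G P : {group gT}).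
Hypothesis sPG : P \subset G.
Variable f : gT -> gT -> F.
Hypothesis cocf : is_cocycle2 P f.
Hypothesis stable_f : {in G, forall g,
  cohomologous (P :&: P :^ g) (fun x y => f (x ^ g^-1)%g (y ^ g^-1)%g) f}.

(** The stable element theorem of Cartan and Eilenberg, in degree two: by
Mackey's formula the restriction of the corestriction is a product over the
double cosets [P g P], and by stability the factor of [P g P] is, up to a
coboundary, the power of [f] of exponent the number of cosets of [P] in
[P g P]. *)
Lemma corestriction_stable :
  exists2 f' : gT -> gT -> F, is_cocycle2 G f' &
    cohomologous P f' (fun x y => f x y ^+ #|G : P|%g).
Proof.
have [r [s rsP]] := double_coset_transversal sPG.
pose t X := (r X * s X)%g; have tP : {in rcosets P G, forall X, t X \in X}.
  by move=> X /rsP[].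
exists (corestriction G P f t); first exact: corestrictionP.
have /fin_all_exists[l lP] : forall g : gT, exists l : gT -> F, g \in G ->
    {in P :&: P :^ g, forall x, l x != 0} /\
    {in P :&: P :^ g &, forall x y,
      f (x ^ g^-1)%g (y ^ g^-1)%g = l x * l y / l (x * y)%g * f x y}.
  move=> g; have [/stable_f[l l0 lM]|_] := boolP (g \in G); first by exists l.
  by exists (fun=> 0).
pose q X x := (s X * x * (s (X :* x))^-1)%g.
have qM X x y : q X (x * y)%g = (q X x * q (X :* x) y)%g.
  by rewrite /q rcosetM !mulgA mulgKV.
have PXM X x : X \in rcosets P G -> x \in P -> (X :* x)%g \in rcosets P G.
  by move=> PX Px; rewrite mem_rcosetsM // (subsetP sPG).
have aE X x : X \in rcosets P G -> x \in P ->
    transversal_cocycle t X x = (q X x ^ (r X)^-1)%g.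
  move=> PX Px; have [_ _ _ /(_ x Px) rXx] := rsP X PX.
  by rewrite /transversal_cocycle /t rXx /q conjgE invgK invMg !mulgA.
have Pq X x : X \in rcosets P G -> x \in P -> q X x \in P.
  move=> PX Px; have [_ PsX _ _] := rsP X PX.
  by have [_ PsXx _ _] := rsP _ (PXM X x PX Px); rewrite !groupM ?groupV.
have Qq X x : X \in rcosets P G -> x \in P -> q X x \in (P :&: P :^ r X)%g.
  move=> PX Px; apply/setIP; split; [exact: Pq | rewrite mem_conjg -aE //].
  exact: (transversal_cocycle_mem tP PX (subsetP sPG x Px)).
(* In the twisted algebra of [P], this is the scalar [c] for which
   [u_(s X) * u_x = c * (u_(q X x) * u_(s (X :* x)))]. *)
pose c X x := f (s X) x / f (q X x) (s (X :* x)%g).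
pose m X x := l (r X) (q X x) / c X x.
exists (fun x => \prod_(X in rcosets P G) m X x) => [x Px|x y Px Py].
  apply/prodf_neq0=> X PX; have [Gr Ps _ _] := rsP X PX.
  have [_ Ps' _ _] := rsP _ (PXM X x PX Px).
  rewrite mulf_neq0 ?invr_eq0 ?mulf_neq0 ?invr_eq0 ?(cocycle2_neq0 cocf) ?Pq //.
  by apply: (lP _ Gr).1; apply: Qq.
have Gx := subsetP sPG x Px.
rewrite -(prod_rcosetsM P (fun X => m X y) Gx) -[#|G : P|%g]/#|rcosets P G|.
rewrite -prodr_const -prodfV -!big_split; apply: eq_bigr => X PX /=.
have PXx := PXM X x PX Px; have PXxy := PXM _ y PXx Py.
have [Gr Ps _ rX] := rsP X PX; have [_ Ps' _ _] := rsP _ PXx.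
have [_ Ps'' _ _] := rsP _ PXxy.
have [l0 lM] := lP _ Gr.
have Qqx := Qq X x PX Px; have Qqy := Qq _ y PXx Py; rewrite rX // in Qqy.
have Pqx := Pq X x PX Px; have Pqy := Pq _ y PXx Py.
rewrite !aE // rX // lM // /m rX // qM /c qM rcosetM.
have e1 := cocycle2_eq cocf Pqx Pqy Ps''.
have e2 := cocycle2_eq cocf Pqx Ps' Py.
have e3 := cocycle2_eq cocf Ps Px Py.
have E1 : (q (X :* x) y * s (X :* x :* y) = s (X :* x) * y)%g.
  by rewrite /q mulgKV.
have E2 : (q X x * s (X :* x) = s X * x)%g by rewrite /q mulgKV.
rewrite E1 in e1; rewrite E2 in e2.
have n1 := cocycle2_neq0 cocf (groupM Pqx Pqy) Ps''.
have n2 := cocycle2_neq0 cocf Ps' Py.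
have n3 := cocycle2_neq0 cocf Ps (groupM Px Py).
have n4 := cocycle2_neq0 cocf Pqx Ps'; have n5 := cocycle2_neq0 cocf Ps Px.
have n6 := cocycle2_neq0 cocf Pqy Ps''; have n7 := l0 _ (groupM Qqx Qqy).
rewrite -[f (q X x) (q _ y)](mulfK n1) e1 -[f x y](mulfK n3) -e3.
rewrite -[f (q X x) (s _ * y)%g](mulKf n2) -e2.
by field; rewrite n1 n2 n3 n4 n5 n6 n7.
Qed.

End StableElements.

(** * Gluing cocycles of the Sylow subgroups *)

(** Burnside's fusion argument: [P] and [P :^ g] are Sylow subgroups of the
centraliser of their intersection, hence conjugate there. *)
Lemma abelian_Sylow_fusion (gT : finGroupType) (G P : {group gT}) p g :
  (p.-Sylow(G) P)%g -> abelian P -> g \in G ->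
  exists2 n, n \in 'N_G(P)%g &
    {in (P :&: P :^ g)%g, forall x, (x ^ g^-1 = x ^ n)%g}.
Proof.
move=> sylP abP Gg; have sPG := pHall_sub sylP.
have sylPg : (p.-Sylow(G) (P :^ g))%g by rewrite pHallJ.
pose C := ('C_G(P :&: P :^ g))%G.
have sCG : C \subset G := subsetIl _ _.
have sPC : P \subset C.
  by rewrite subsetI sPG; apply: subset_trans abP (centS (subsetIl _ _)).
have sPgC : (P :^ g)%g \subset C.
  rewrite subsetI (pHall_sub sylPg) /=.
  apply: subset_trans (centS (subsetIr _ _)).
  by rewrite -[(_ \subset _)]/(abelian (P :^ g)) abelianJ.
have [c Cc eP] := Sylow_trans (pHall_subl sPC sCG sylP)
  (pHall_subl sPgC sCG sylPg).
have [Gc cc] := setIP Cc.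
exists (c * g^-1)%g => [|x Qx].
  rewrite inE groupM ?groupV //=; apply/normP.
  by rewrite conjsgM -eP conjsgK.
by rewrite conjgM; congr (_ ^ _)%g; rewrite /conjg -(centP cc x Qx) mulKg.
Qed.

Lemma cohomologous_sub (F : fieldType) (gT : finGroupType) (H G : {group gT})
    (f1 f2 : gT -> gT -> F) :
  H \subset G -> cohomologous G f1 f2 -> cohomologous H f1 f2.
Proof.
move=> /subsetP sHG [l l0 e].
by exists l => [x /sHG|x y /sHG Gx /sHG]; [apply: l0 | apply: e].
Qed.

Lemma eq_cohomologous (F : fieldType) (gT : finGroupType) (G : {group gT})
    (f1 f1' f2 : gT -> gT -> F) :
  {in G &, f1 =2 f1'} -> cohomologous G f1 f2 -> cohomologous G f1' f2.
Proof. by move=> e [l l0 h]; exists l => // x y Gx Gy; rewrite -e // h. Qed.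

Lemma is_cocycle2_mul (F : fieldType) (gT : finGroupType) (G : {group gT})
    (f1 f2 : gT -> gT -> F) :
  is_cocycle2 G f1 -> is_cocycle2 G f2 ->
  is_cocycle2 G (fun x y => f1 x y * f2 x y).
Proof.
move=> [n1 c1] [n2 c2]; split=> [x y Gx Gy|x y z Gx Gy Gz].
  by rewrite mulf_neq0 ?n1 ?n2.
by rewrite mulrACA c1 // c2 // mulrACA.
Qed.

Lemma is_cocycle2_exp (F : fieldType) (gT : finGroupType) (G : {group gT})
    (f : gT -> gT -> F) n :
  is_cocycle2 G f -> is_cocycle2 G (fun x y => f x y ^+ n).
Proof.
move=> [n0 c]; split=> [x y Gx Gy|x y z Gx Gy Gz].
  by rewrite expf_neq0 ?n0.
by rewrite -!exprMn c.
Qed.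

Lemma alt_form_exp (F : fieldType) (gT : finGroupType) (f : gT -> gT -> F)
    n x y :
  alt_form (fun u v => f u v ^+ n) x y = alt_form f x y ^+ n.
Proof. by rewrite /alt_form expr_div_n. Qed.

(** The exponent of the corestriction is a [p']-number, so that it keeps regular
elements of [P] regular; raised once more to the power [#|G : P|], the
commutator pairing dies on the Sylow subgroups for the other primes. *)
Lemma Sylow_cocycle_extension (F : fieldType) (gT : finGroupType)
    (G P : {group gT}) (f : gT -> gT -> F) p :
  (p.-Sylow(G) P)%g -> abelian P -> is_cocycle2 P f ->
  {in 'N_G(P)%g, forall n,
    cohomologous P (fun x y => f (x ^ n)%g (y ^ n)%g) f} ->
  regular_trivial P f ->
  exists f' : gT -> gT -> F,
    [/\ is_cocycle2 G f', regular_trivial P f' &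
        forall q (Q : {group gT}), q != p -> (q.-Sylow(G) Q)%g -> abelian Q ->
          {in Q &, forall x y, f' x y = f' y x}].
Proof.
move=> sylP abP cocf inv_f regP; have sPG := pHall_sub sylP.
have stable_f : {in G, forall g,
    cohomologous (P :&: P :^ g) (fun x y => f (x ^ g^-1)%g (y ^ g^-1)%g) f}.
  move=> g Gg; have [n Nn fus] := abelian_Sylow_fusion sylP abP Gg.
  apply: eq_cohomologous (cohomologous_sub (subsetIl P _) (inv_f n Nn)).
  by move=> x y Qx Qy; rewrite !fus.
have [f1 coc1 res1] := corestriction_stable sPG cocf stable_f.
have [_ _ p'N] := and3P sylP.
exists (fun x y => f1 x y ^+ #|G : P|%g); split; first exact: is_cocycle2_exp.
  move=> x Px regx; apply: (regP x Px) => y Cy; have [Py cxy] := setIP Cy.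
  have Gx := subsetP sPG x Px; have Gy := subsetP sPG y Py.
  apply/eqP; rewrite -(alt_form_eq1 cocf) //; apply/eqP.
  apply: (@coprime_expr_eq1 _ _ (#|G : P|%g * #|G : P|%g) #[y]%g).
  - rewrite coprime_sym; apply: (@pnat_coprime p).
      exact: mem_p_elt (pHall_pgroup sylP) Py.
    by rewrite pnatM p'N.
  - rewrite exprM -alt_form_exp -(alt_form_cohomologous _ res1) //; last first.
    + by apply/commute_sym/cent1P.
    + exact: is_cocycle2_exp.
    rewrite -alt_form_exp; apply/eqP.
    by rewrite (alt_form_eq1 (is_cocycle2_exp _ coc1)) //; apply/eqP/regx.
  exact: (alt_form_order cocf Px Cy).
move=> q Q neq_qp sylQ abQ x y Qx Qy.
have sQG := pHall_sub sylQ.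
have Gx := subsetP sQG x Qx; have Gy := subsetP sQG y Qy.
apply/eqP; rewrite -(alt_form_eq1 (is_cocycle2_exp _ coc1)) // alt_form_exp.
apply/eqP; apply: (@expr_dvd _ #[y]%g).
  apply: (alt_form_order coc1) => //; rewrite inE Gy.
  by apply/cent1P; apply: (centsP abQ).
apply: dvdn_trans (order_dvdG Qy) _; rewrite (card_Hall sylQ).
rewrite -(Lagrange sPG) partnM // [(#|P|`_q)%N]part_p'nat ?mul1n ?dvdn_part //.
apply: sub_in_pnat (pHall_pgroup sylP) => r _ /eqnP ->.
by rewrite !inE eq_sym.
Qed.

Lemma regular_trivial_mul (F : fieldType) (gT : finGroupType) (P : {group gT})
    (f1 f2 : gT -> gT -> F) :
  {in P &, forall x y, f1 x y != 0} -> {in P &, forall x y, f1 x y = f1 y x} ->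
  regular_trivial P f2 -> regular_trivial P (fun x y => f1 x y * f2 x y).
Proof.
move=> nz sym reg x Px regx; apply: (reg x Px) => y Cy; have [Py _] := setIP Cy.
by have := regx y Cy; rewrite sym // => /(mulfI (nz y x Py Px)).
Qed.

(** Induction on the list of primes: multiplying by a cocycle that is symmetric
on a Sylow subgroup does not change the regular elements there. *)
Lemma Sylow_cocycles_glue (F : fieldType) (gT : finGroupType) (G : {group gT})
    (S : nat -> {group gT}) (s : seq nat) :
  A_type G -> (forall p, prime p -> (p.-Sylow(G) (S p))%g) ->
  uniq s -> {in s, forall p, prime p} ->
  (forall p, prime p -> exists f : gT -> gT -> F,
     [/\ is_cocycle2 (S p) f, regular_trivial (S p) f &
       {in 'N_G(S p)%g, forall n,
         cohomologous (S p) (fun x y => f (x ^ n)%g (y ^ n)%g) f}]) ->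
  exists f : gT -> gT -> F, [/\ is_cocycle2 G f,
    {in s, forall p, regular_trivial (S p) f} &
    forall p, prime p -> p \notin s -> {in S p &, forall x y, f x y = f y x}].
Proof.
move=> A_G sylS us prs exf.
elim: s us prs => [_ _|p s IHs /= /andP[nsp us] prs].
  exists (fun _ _ => 1); split=> //; split=> [x y _ _|x y z _ _ _ //].
  exact: oner_neq0.
have prs' : {in s, forall q, prime q}.
  by move=> q sq; rewrite prs // inE sq orbT.
have [f2 [coc2 reg2 sym2]] := IHs us prs'.
have p_pr : prime p by apply: prs; rewrite mem_head.
have [f [cocf regf invf]] := exf p p_pr.
have abS q (q_pr : prime q) : abelian (S q) := A_G q _ q_pr (sylS q q_pr).
have [f1 [coc1 reg1 sym1]] :=
  Sylow_cocycle_extension (sylS p p_pr) (abS p p_pr) cocf invf regf.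
have nzS (h : gT -> gT -> F) q : is_cocycle2 G h -> prime q ->
    {in S q &, forall x y, h x y != 0}.
  move=> coch q_pr x y Sx Sy; have sSG := pHall_sub (sylS q q_pr).
  by rewrite (cocycle2_neq0 coch) ?(subsetP sSG).
exists (fun x y => f1 x y * f2 x y); split; first exact: is_cocycle2_mul.
  move=> q; rewrite inE; have [-> _|neq_qp /= sq] := eqVneq q p.
    have -> : (fun x y => f1 x y * f2 x y) = (fun x y => f2 x y * f1 x y).
      by apply/funext=> x; apply/funext=> y; rewrite mulrC.
    by apply: regular_trivial_mul reg1; [apply: nzS | apply: sym2].
  have q_pr := prs' q sq.
  apply: regular_trivial_mul (reg2 q sq); first exact: nzS.
  exact: (sym1 q _ neq_qp (sylS q q_pr) (abS q q_pr)).
move=> q q_pr; rewrite inE negb_or => /andP[neq_qp nsq] x y Sx Sy.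
rewrite (sym2 q) //; congr (_ * _).
exact: (sym1 q _ neq_qp (sylS q q_pr) (abS q q_pr)).
Qed.

Lemma Weyl_actionVE (gT : finGroupType) (G H : {group gT}) (cHH : abelian H)
    x g :
  x \in H -> g \in 'N_G(H)%g ->
  ((actperm (Weyl_action G cHH) (coset H g))^-1)%g x = (x ^ g^-1)%g.
Proof.
move=> Hx Ng; have [_ nHg] := setIP Ng.
apply: (@perm_inj _ (actperm (Weyl_action G cHH) (coset H g))).
rewrite permKV Weyl_actionE ?conjgKV //.
by rewrite memJ_norm // groupV.
Qed.

(* S p is the p-Sylow subgroup G_p; the choice of S is arbitrary, and the    *)
(* proof that S p is abelian, on which the Weyl action depends, is A_G.       *)
Theorem theorem3p18 (R : realType) (gT : finGroupType) (G : {group gT})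
    (A_G : A_type G) (S : nat -> {group gT})
    (sylS : forall p : nat, prime p -> (p.-Sylow(G) (S p))%g) :
  central_type R[i] G <->
  (forall (p : nat) (p_pr : prime p),
     central_type R[i] (S p) /\
     symplectic R[i] (Weyl_action G (A_G p (S p) p_pr (sylS p p_pr)))).
Proof.
split=> [[f ndf] p p_pr | H].
  have cocf := cocycle2P f; have sylP := sylS p p_pr; have sPG := pHall_sub sylP.
  pose fP := Cocycle2 (is_cocycle2_sub sPG cocf).
  have ndP : Defs.nondegenerate fP.
    apply: regular_trivial_nondegenerate.
    apply: (regular_trivial_Sylow cocf sylP (A_G p _ p_pr sylP)).
    exact: nondegenerate_regular_trivial.
  split; first by exists fP.
  exists fP => // _ /morphimP[g Ng GNg ->].
  have Gg : (g^-1)%g \in G by rewrite groupV; case/setIP: GNg.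
  apply: eq_cohomologous (cohomologous_sub sPG (cohomologous_conj cocf Gg)).
  by move=> x y Px Py; rewrite /aut_act_cocycle !Weyl_actionVE.
have [f [cocf regf _]] : exists f : gT -> gT -> R[i], [/\ is_cocycle2 G f,
    {in primes #|G|, forall p, regular_trivial (S p) f} &
    forall p, prime p -> p \notin primes #|G| ->
      {in S p &, forall x y, f x y = f y x}].
  apply: Sylow_cocycles_glue => //; first exact: primes_uniq.
    by move=> p; rewrite mem_primes => /andP[].
  move=> p p_pr; have [_ [f ndf invf]] := H p p_pr.
  exists f; split; first exact: cocycle2P.
    exact: nondegenerate_regular_trivial.
  (* [aut_act_cocycle] precomposes with the inverse automorphism. *)
  move=> n Nn; have Nn' : (n^-1)%g \in 'N_G(S p)%g by rewrite groupV.
  have Wn : coset (S p) n^-1%g \in Weyl_group G (S p) by rewrite mem_quotient.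
  apply: eq_cohomologous (invf _ Wn) => x y Px Py.
  by rewrite /aut_act_cocycle !Weyl_actionVE // invgK.
exists (Cocycle2 cocf); apply: Sylow_regular_trivial_nondegenerate => p p_pr.
exists (S p); first exact: (sylS p p_pr).
have [pG|npG] := boolP (p \in primes #|G|); first exact: regf.
move=> x Sx _; apply/set1gP; suff <- : S p :=: 1%g by [].
apply: card1_trivg; rewrite (card_Hall (sylS p p_pr)).
by apply/eqP; rewrite p_part_eq1.
Qed.
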